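(* Let $(H,\circ)$ be a regular hypersemigroup and let $f:H\to[0,1]$ be a fuzzy subset of $H$. Then $f$ is a fuzzy ideal of $H$ if and only if $f$ is a fuzzy interior ideal of $H$.
   Context: A hypergroupoid is a nonempty set $H$ with a map $\circ: H\times H\to \mathcal{P}^*(H)$, where $\mathcal{P}^*(H)$ is the set of nonempty subsets of $H$. For $A,B\in\mathcal{P}^*(H)$ put $A*B=\bigcup_{(a,b)\in A\times B}(a\circ b)$; thus $\{x\}*\{y\}=x\circ y$. A hypersemigroup is a hypergroupoid with $\{x\}*(y\circ z)=(x\circ y)*\{z\}$ for all $x,y,z\in H$; then $*$ is associative on $\mathcal{P}^*(H)$. A hypersemigroup $H$ is regular if for every $a\in H$ there exists $x\in H$ such that $a\in\{a\}*(x\circ a)$. A fuzzy subset of $H$ is a map $f:H\to[0,1]$ (real interval). It is a fuzzy left ideal if for all $x,y\in H$ and all $u\in x\circ y$, $f(u)\ge f(y)$; a fuzzy right ideal if for all $x,y\in H$ and all $u\in x\circ y$, $f(u)\ge f(x)$; a fuzzy ideal if it is both a fuzzy left ideal and a fuzzy right ideal. It is a fuzzy interior ideal if for all $x,a,y\in H$ and all $u\in (x\circ a)*\{y\}$, $f(u)\ge f(a)$. *)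

(* Defs.v *)
From mathcomp Require Import all_boot all_order all_algebra.
From mathcomp Require Import classical_sets reals interval_inference.

Set Implicit Arguments.
Unset Strict Implicit.
Unset Printing Implicit Defensive.

Import Order.TTheory GRing.Theory Num.Theory.

Local Open Scope classical_set_scope.
Local Open Scope ring_scope.

(* The codomain P^*(H) (nonempty subsets) is encoded as [set H] together with
   the field [hop_nonempty]. *)
Record hypergroupoid := Hypergroupoid {
  hcarrier :> Type;
  hop : hcarrier -> hcarrier -> set hcarrier;
  hcarrier_nonempty : [set: hcarrier] !=set0;
  hop_nonempty : forall x y, hop x y !=set0 }.

Definition hstar (H : hypergroupoid) (A B : set H) : set H :=
  \bigcup_(p in A `*` B) hop p.1 p.2.

Definition hypersemigroup (H : hypergroupoid) : Prop :=
  forall x y z : H, hstar [set x] (hop y z) = hstar (hop x y) [set z].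

Definition regular (H : hypergroupoid) : Prop :=
  forall a : H, exists x : H, hstar [set a] (hop x a) a.

(* [{i01 R}] is the library's type of the elements of R lying in [0, 1], and
   [t%:num] is the underlying element of R. *)
Definition fuzzy_subset (R : realType) (H : hypergroupoid) := H -> {i01 R}.

Section FuzzyIdeals.
Variables (R : realType) (H : hypergroupoid).
Implicit Type f : fuzzy_subset R H.

Definition fuzzy_left_ideal f : Prop :=
  forall x y u : H, hop x y u -> (f u)%:num >= (f y)%:num.

Definition fuzzy_right_ideal f : Prop :=
  forall x y u : H, hop x y u -> (f u)%:num >= (f x)%:num.

Definition fuzzy_ideal f : Prop := fuzzy_left_ideal f /\ fuzzy_right_ideal f.

Definition fuzzy_interior_ideal f : Prop :=
  forall x a y u : H,
    hstar (hop x a) [set y] u -> (f u)%:num >= (f a)%:num.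

End FuzzyIdeals.

(* Main.v *)
Require Import Defs.
From mathcomp Require Import all_boot all_order all_algebra.
From mathcomp Require Import classical_sets reals interval_inference.

(** A fuzzy ideal is a fuzzy interior ideal: an element of
    [(x o a) * {y}] lies in some [w o y] with [w] in [x o a], so the right ideal
    condition followed by the left one bounds its degree below by that of [a].

    For the converse, regularity makes every element absorb a factor on either
    side: from [a] in [{a} * (x o a)] one gets [a] in [a o v] for some [v], and
    reassociating, [a] in [w o a] for some [w]. Hence a product [x o y] may be
    enlarged to a triple product having the factor of interest in the middle:
    [x o y] is contained in [(w o x) * {y}] and in [{x} * (y o v)], the latter
    being [(x o y) * {v}]. The interior ideal condition then yields the right
    and the left ideal conditions respectively. *)

Lemma hstar_set1r (H : hypergroupoid) (A : set H) (y u : H) :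
  hstar A [set y]%classic u <-> exists2 w, A w & hop w y u.
Proof.
split=> [[[w y'] /= [Aw ->] wyu]|[w Aw wyu]]; first by exists w.
by exists (w, y).
Qed.

Lemma hstar_set1l (H : hypergroupoid) (B : set H) (x u : H) :
  hstar [set x]%classic B u <-> exists2 v, B v & hop x v u.
Proof.
split=> [[[x' v] /= [-> Bv] xvu]|[v Bv xvu]]; first by exists v.
by exists (x, v).
Qed.

Lemma regular_absorbr {H : hypergroupoid} (regularH : regular H) (a : H) :
  exists v, hop a v a.
Proof.
by have [x /hstar_set1l[v _ ava]] := regularH a; exists v.
Qed.

(** Regularity is stated with the product grouped to the right, which exhibits
    [a] only as a left factor; associativity regroups it as [(a o x) * {a}]. *)
Lemma regular_absorbl {H : hypergroupoid} (hypersemigroupH : hypersemigroup H)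
    (regularH : regular H) (a : H) :
  exists w, hop w a a.
Proof.
have [x] := regularH a; rewrite hypersemigroupH.
by case/hstar_set1r=> w _ waa; exists w.
Qed.

Lemma fuzzy_ideal_interior (R : realType) (H : hypergroupoid)
    (f : fuzzy_subset R H) :
  fuzzy_ideal f -> fuzzy_interior_ideal f.
Proof.
move=> [leftf rightf] x a y u /hstar_set1r[w xaw wyu].
exact: Order.POrderTheory.le_trans (leftf _ _ _ xaw) (rightf _ _ _ wyu).
Qed.

Lemma fuzzy_interior_ideal_left (R : realType) (H : hypergroupoid)
    (hypersemigroupH : hypersemigroup H) (regularH : regular H)
    (f : fuzzy_subset R H) :
  fuzzy_interior_ideal f -> fuzzy_left_ideal f.
Proof.
move=> interiorf x y u xyu; have [v yvy] := regular_absorbr regularH y.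
apply: (interiorf x y v); rewrite -hypersemigroupH.
by apply/hstar_set1l; exists y.
Qed.

Lemma fuzzy_interior_ideal_right (R : realType) (H : hypergroupoid)
    (hypersemigroupH : hypersemigroup H) (regularH : regular H)
    (f : fuzzy_subset R H) :
  fuzzy_interior_ideal f -> fuzzy_right_ideal f.
Proof.
move=> interiorf x y u xyu.
have [w wxx] := regular_absorbl hypersemigroupH regularH x.
by apply: (interiorf w x y); apply/hstar_set1r; exists x.
Qed.

Theorem theorem2p9 (R : realType) (H : hypergroupoid)
    (hypersemigroupH : hypersemigroup H) (regularH : regular H)
    (f : fuzzy_subset R H) :
  fuzzy_ideal f <-> fuzzy_interior_ideal f.
Proof.
split=> [|interiorf]; first exact: fuzzy_ideal_interior.
by split; [apply: fuzzy_interior_ideal_left | apply: fuzzy_interior_ideal_right].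
Qed.
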